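(* Fix the structure vector $\boldsymbol{\ell}=(\ell_1,\dots,\ell_{\mathcal K})$ and let $N=R$. There exist constants $C^{(3)},C^{(4)}$, depending only on $\boldsymbol\ell$ (in particular not on $\eta$), such that the following holds. Let $\mathbf{x}\in\mathbb{C}^{R}$ be a data point with $|z_j|=1$ for $j=1,\dots,\mathcal K$, with $\eta=\eta(\mathbf{x})>0$, with $a_{\ell_j-1,j}\neq 0$ for $j=1,\dots,\mathcal{K}$, and with $|a_{\ell,j}|\le A$ for all $\ell,j$. Then the Jacobian matrix $\mathcal{J}_R(\mathbf{x})$ is invertible. Furthermore, for every $j=1,\dots,\mathcal K$, $$\kappa_{L_j+\ell,R}(\mathbf{x})\le C^{(3)}A\left(\frac{1}{\eta^{(j)}}\right)^{R-\ell}\left(1+\frac{|a_{\ell-1,j}|}{|a_{\ell_j-1,j}|}\right),\qquad \ell=0,\dots,\ell_j-1,$$ $$\kappa_{L_j+\ell_j,R}(\mathbf{x})\le C^{(4)}A\left(\frac{1}{\eta^{(j)}}\right)^{R-\ell_j}\cdot\frac{1}{|a_{\ell_j-1,j}|}.$$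
   Context: Let $\mathcal K\ge 1$ and let $\boldsymbol{\ell}=(\ell_1,\dots,\ell_{\mathcal K})$ be a vector of positive integers (the problem structure vector). Put $R=\sum_{i=1}^{\mathcal K}\ell_i+\mathcal K$ and $L_j=1+\sum_{m=1}^{j-1}(\ell_m+1)$. A data point is a vector $\mathbf{x}=(a_{0,1},\dots,a_{\ell_1-1,1},z_1,\dots,a_{0,\mathcal K},\dots,a_{\ell_{\mathcal K}-1,\mathcal K},z_{\mathcal K})^T\in\mathbb{C}^R$, so that $a_{\ell,j}$ is the coordinate number $L_j+\ell$ and $z_j$ is the coordinate number $L_j+\ell_j$. Put $a_{-1,j}:=0$. The forward map $\mathcal{P}_R:\mathbb{C}^R\to\mathbb{C}^R$ is $\mathcal{P}_R(\mathbf{x})=(m_0,\dots,m_{R-1})^T$, where $m_k=\sum_{j=1}^{\mathcal K}z_j^k\sum_{\ell=0}^{\ell_j-1}a_{\ell,j}k^\ell$ (with $0^0=1$). $\mathcal{J}_R(\mathbf{x})=d\mathcal{P}_R(\mathbf{x})\in\mathbb{C}^{R\times R}$ is its Jacobian matrix. When $\mathcal{J}_R(\mathbf{x})$ is invertible, the componentwise condition number of parameter $\alpha\in\{1,\dots,R\}$ is $$\kappa_{\alpha,R}(\mathbf{x})=\sum_{i=1}^R\left|\left(\mathcal{J}_R(\mathbf{x})^{-1}\right)_{\alpha,i}\right|\,|m_{i-1}|.$$ For a data point with $|z_j|=1$ for all $j$, the node separation is $\eta^{(j)}=\min_{r\ne j}|\arg z_j-\arg z_r|$, angles being measured modulo $2\pi$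 with the convention $\eta^{(j)}\le\pi$ (so an empty minimum is read as $\pi$), and $\eta=\eta(\mathbf{x})=\min_j\eta^{(j)}$. *)

(* Defs.v *)
From mathcomp Require Import all_boot all_order all_algebra.
From mathcomp Require Import all_classical all_reals all_analysis.
From mathcomp Require Import complex.

Set Implicit Arguments.
Unset Strict Implicit.
Unset Printing Implicit Defensive.

Import Order.TTheory GRing.Theory Num.Theory numFieldNormedType.Exports.
Import ComplexField.Normc.

Local Open Scope ring_scope.
Local Open Scope complex_scope.
Local Open Scope classical_set_scope.

(* The principal argument, in ]-pi, pi]; see argP. *)
Definition arg (R : realType) (w : R[i]) : R :=
  xget 0 [set t | - pi < t <= pi /\
                  w = (normc w * cos t) +i* (normc w * sin t)].

Lemma argP (R : realType) (w : R[i]) :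
  - pi < arg w <= pi /\
  w = (normc w * cos (arg w)) +i* (normc w * sin (arg w)).
Proof.
rewrite /arg; set P : set R := (X in xget _ X).
suff [t Pt] : exists t, P t by exact: (xgetPex 0 (ex_intro _ t Pt)).
have pi0 : 0 < (pi : R) := pi_gt0 R.
case: w @P => a b P; set r := normc (a +i* b) in P *.
have r2 : r ^+ 2 = a ^+ 2 + b ^+ 2.
  by rewrite /r /= sqr_sqrtr // addr_ge0 ?sqr_ge0.
have [r0|r_neq0] := eqVneq r 0.
  exists 0; rewrite /P /=; split; first by rewrite oppr_lt0 pi0 ltW.
  by rewrite -/r r0 !mul0r (eq0_normc r0).
have r_gt0 : 0 < r by rewrite lt_def r_neq0 /r sqrtr_ge0.
pose c := a / r; pose s := b / r.
have rc : r * c = a by rewrite /c mulrC divfK.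
have rs : r * s = b by rewrite /s mulrC divfK.
have cs1 : c ^+ 2 + s ^+ 2 = 1.
  by rewrite /c /s !expr_div_n -mulrDl -r2 divff // expf_neq0.
have c1 : -1 <= c <= 1.
  rewrite -ler_norml -(@ler_pXn2r _ 2) ?nnegrE // real_normK ?num_real //.
  by rewrite expr1n -cs1 lerDl sqr_ge0.
have [/andP[t0 tpi] cost] := acos_def c1.
have sint : sin (acos c) = `|s|.
  by rewrite sin_acos // -cs1 addrAC subrr add0r sqrtr_sqr.
have [s0|s0] := leP 0 s.
  exists (acos c); rewrite /P /=; split.
    by rewrite tpi andbT (lt_le_trans _ t0) // oppr_lt0.
  by rewrite -/r cost sint ger0_norm // rc rs.
exists (- acos c); rewrite /P /=; split.
  rewrite (le_trans _ (ltW pi0)) ?oppr_le0 // andbT ltrN2 lt_neqAle tpi andbT.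
  apply/eqP => tE; move: sint; rewrite tE sinpi => /esym/eqP.
  by rewrite normr_eq0 lt_eqF.
by rewrite -/r cosN sinN cost sint ltr0_norm // opprK rc rs.
Qed.

(* |arg u - arg v| measured modulo 2 pi, a number in [0, pi]. *)
Definition angdist (R : realType) (u v : R[i]) : R :=
  Num.min `|arg u - arg v| (2 * pi - `|arg u - arg v|).

Section Prony.
Variables (R : realType) (K : nat) (l : 'I_K -> nat).

Definition dimR : nat := (\sum_(j < K) l j + K)%N.

(* Coordinates are numbered from 0 here, so [offset j] is L_j - 1. *)
Definition offset (j : 'I_K) : nat := (\sum_(m < K | m < j) (l m).+1)%N.

Lemma offset_lt (j : 'I_K) (k : 'I_(l j).+1) : (offset j + k < dimR)%N.
Proof.
have -> : dimR = (\sum_(m < K) (l m).+1)%N.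
  under [RHS]eq_bigr do rewrite -addn1.
  by rewrite big_split /= sum1_card card_ord.
rewrite [X in (_ < X)%N](bigID (fun m : 'I_K => m < j)%N) /= -/(offset j).
rewrite ltn_add2l (bigD1 j) /= ?ltnn //.
by rewrite (leq_trans (ltn_ord k)) // leq_addr.
Qed.

(* The coordinate of a_{k,j} when k < l_j, and of z_j when k = l_j. *)
Definition idx (j : 'I_K) (k : 'I_(l j).+1) : 'I_dimR :=
  Ordinal (offset_lt k).

(* The index of the parameter a_{k,j}; only meaningful for k < l_j. *)
Definition idxa (j : 'I_K) (k : nat) : 'I_dimR := @idx j (inord k).
Definition idxz (j : 'I_K) : 'I_dimR := @idx j ord_max.

Definition coefa (x : 'rV[R[i]]_dimR) (j : 'I_K) (k : nat) : R[i] :=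
  x 0 (idxa j k).
Definition node (x : 'rV[R[i]]_dimR) (j : 'I_K) : R[i] := x 0 (idxz j).

(* a_{k-1,j}, with the convention a_{-1,j} = 0. *)
Definition coefa_prev (x : 'rV[R[i]]_dimR) (j : 'I_K) (k : nat) : R[i] :=
  if k is k'.+1 then coefa x j k' else 0.

Definition forward (x : 'rV[R[i]]_dimR) : 'rV[R[i]]_dimR :=
  \row_(k < dimR) \sum_(j < K)
    node x j ^+ k * \sum_(i < l j) coefa x j i * k%:R ^+ i.

(* The complex (holomorphic) differential. The library's [jacobian] acts on
   row vectors from the right, hence the transpose: entry (i, k) is the partial
   derivative of m_i with respect to the coordinate k. *)
Definition jac (x : 'rV[R[i]]_dimR) : 'M[R[i]]_dimR := (jacobian forward x)^T.

Definition kappa (alpha : 'I_dimR) (x : 'rV[R[i]]_dimR) : R :=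
  \sum_(i < dimR) normc (invmx (jac x) alpha i) * normc (forward x 0 i).

(* angdist is at most pi, so the unit pi only matters for an empty minimum. *)
Definition nodesep (x : 'rV[R[i]]_dimR) (j : 'I_K) : R :=
  \big[Num.min/pi]_(r < K | r != j) angdist (node x j) (node x r).

Definition sep (x : 'rV[R[i]]_dimR) : R :=
  \big[Num.min/pi]_(j < K) nodesep x j.

End Prony.

(* Main.v *)
From HB Require Import structures.
Require Import Defs.
From mathcomp Require Import all_boot all_order all_algebra.
From mathcomp Require Import all_classical all_reals all_analysis.
From mathcomp Require Import complex.
From mathcomp Require Import ring lra.

Set Implicit Arguments.
Unset Strict Implicit.
Unset Printing Implicit Defensive.

Import Order.TTheory GRing.Theory Num.Theory numFieldNormedType.Exports.
Import ComplexField.Normc.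

Local Open Scope ring_scope.

(** The column of the Jacobian matrix at a_(k,j) has entries i^k z_j^i, and the
    column at z_j is z_j^-1 times the combination of the vectors
    i^(q+1) z_j^i with coefficients a_(q,j). Hence J = V D, where V is the
    confluent Vandermonde matrix with columns i^k z_j^i for 0 <= k <= l_j, and
    D is block triangular with last pivots a_(l_j-1,j) / z_j, which do not
    vanish. So the rows of J^-1 are explicit in terms of the basis w_(j,k) dual
    to the columns of V: the row of a_(k,j) is
    w_(j,k) - (a_(k-1,j) / a_(l_j-1,j)) w_(j,l_j), and the row of z_j is
    (z_j / a_(l_j-1,j)) w_(j,l_j) ([coef_row], [node_row]). Since |m_i| is at
    most a constant times A, only the size of the dual vectors matters.

    Read a row vector w as the polynomial with coefficients w_i. Its pairing
    with the column i^k z^i is the value at z of (X d/dX)^k w. So w_(j,m) is the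
    solution of a Hermite interpolation problem with the Euler derivation
    theta = X d/dX in place of d/dX: it vanishes to order l_r + 1 at every other
    node z_r, and theta^k w_(j,m) (z_j) = delta_(km) for k <= l_j.

    To solve it with bounds, let Q be the product of the factors
    (X - z_r) / (z_j - z_r), each repeated l_r + 1 times, and let
    F_m = (X - z_j)^m Q. If delta <= 1 bounds the distances from z_j to the other
    nodes from below, then |theta^i F_m (z_j)| = O(delta^(m-i)), because this
    scaling holds for each linear factor and is stable under products
    ([eulerM_le]); and the coefficients of F_m have sum O(delta^-(deg Q)). The
    matrix of the values theta^i F_m (z_j) is triangular with diagonal m! z_j^m,
    and inverting it by downward induction on m gives
    |w_(j,m)|_1 = O(delta^-(R-1-m)) ([hermite_dual]), one power better than
    required. Finally delta can be taken proportional to the angular separation,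
    because chords of the unit circle are comparable to arcs ([chord_ge]). *)

(** * The Euler derivation on polynomials *)

Section Euler.
Variable F : numFieldType.
Implicit Types (p q : {poly F}) (a b : F).

(** The operator (X d/dX)^i, which multiplies the coefficient of X^k by k^i. *)
Definition euler (i : nat) p : {poly F} :=
  \poly_(k < size p) (k%:R ^+ i * p`_k).

Lemma coef_euler i p k : (euler i p)`_k = k%:R ^+ i * p`_k.
Proof.
by rewrite coef_poly; case: ltnP => // hk; rewrite (nth_default _ hk) mulr0.
Qed.

Lemma euler_is_linear i : linear (euler i).
Proof.
move=> c p q; apply/polyP => k.
by rewrite !(coefD, coefZ, coef_euler) mulrDr mulrCA.
Qed.

HB.instance Definition _ i :=
  GRing.isLinear.Build F {poly F} {poly F} _ (euler i) (euler_is_linear i).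

Lemma euler0 p : euler 0 p = p.
Proof. by apply/polyP => k; rewrite coef_euler mul1r. Qed.

Lemma eulerS i p : euler i.+1 p = euler i ('X * p^`()).
Proof.
apply/polyP => k; rewrite !coef_euler coefXM; case: k => [|k] /=.
  by rewrite expr0n mul0r mulr0.
by rewrite coef_deriv exprSr -mulrA mulr_natl.
Qed.

(** The pairing of the coefficients of p with a column of the confluent
    Vandermonde matrix is a value of the Euler derivative of p. *)
Lemma horner_euler i p b n : (size p <= n)%N ->
  (euler i p).[b] = \sum_(k < n) p`_k * (k%:R ^+ i * b ^+ k).
Proof.
move=> hn; rewrite (@horner_coef_wide _ n).
  by apply: eq_bigr => k _; rewrite coef_euler mulrAC mulrC.
exact: leq_trans (size_poly _ _) hn.
Qed.

Lemma horner_euler1 i b : (euler i 1).[b] = 0 ^+ i.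
Proof.
case: i => [|i]; first by rewrite euler0 hornerC.
by rewrite eulerS -polyC1 derivC mulr0 linear0 horner0 expr0n.
Qed.

(** Geometric growth of the Euler derivatives at a point is stable under
    products, with added rates: since the Euler operator is a derivation, this is
    the binomial formula. The induction applies the derivation once to each factor,
    which has the same effect as replacing A by A c or B by B d. *)
Lemma eulerM_le b p q (A B c d : F) :
  (forall i, `|(euler i p).[b]| <= A * c ^+ i) ->
  (forall i, `|(euler i q).[b]| <= B * d ^+ i) ->
  forall i, `|(euler i (p * q)).[b]| <= A * B * (c + d) ^+ i.
Proof.
move=> hp hq i; elim: i p q A B hp hq => [|i IH] p q A B hp hq.
  have := hp 0%N; have := hq 0%N; rewrite !euler0 !expr0 !mulr1 hornerM normrM.
  by move=> *; rewrite ler_pM.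
rewrite eulerS derivM.
have -> : 'X * (p^`() * q + p * q^`()) =
          ('X * p^`()) * q + p * ('X * q^`()) by ring.
rewrite linearD hornerD.
apply: le_trans (ler_normD _ _) _.
rewrite exprSr mulrDr mulrDr.
have h1 := IH _ _ (A * c) B _ hq; have h2 := IH _ _ A (B * d) hp _.
rewrite [leRHS](_ : _ = A * c * B * (c + d) ^+ i + A * (B * d) * (c + d) ^+ i).
  apply: lerD; [apply: h1 | apply: h2] => r.
    by rewrite -eulerS -mulrA -exprS.
  by rewrite -eulerS -mulrA -exprS.
ring.
Qed.

(** One Euler derivation turns (X - b)^(m+1) q into (X - b)^m q' with
    q'(b) = (m + 1) b q(b); hence both the vanishing below order m and the value at
    order m. *)
Lemma euler_XsubC_exp b m q i : (i <= m)%N ->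
  (euler i (('X - b%:P) ^+ m * q)).[b] = (m`!%:R * b ^+ m * q.[b]) *+ (i == m).
Proof.
elim: i m q => [|i IH] m q im.
  rewrite euler0 hornerM horner_exp hornerXsubC subrr expr0n; case: m {im} => [|m].
    by rewrite !mul1r.
  by rewrite mul0r.
case: m im => // m im; rewrite eulerS derivM deriv_exp derivXsubC mul1r /=.
rewrite (_ : 'X * _ = ('X - b%:P) ^+ m *
    (m.+1%:R *: ('X * q) + ('X - b%:P) * ('X * q^`()))).
  rewrite IH // hornerD hornerZ !hornerM hornerXsubC subrr mul0r addr0 hornerX.
  by rewrite factS natrM exprS eqSS; congr (_ *+ _); ring.
by rewrite scaler_nat exprSr; ring.
Qed.

Lemma euler_dvd b m p i :
  (('X - b%:P) ^+ m %| p)%R -> (i < m)%N -> (euler i p).[b] = 0.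
Proof.
move=> /dvdpP[q ->] im; rewrite mulrC euler_XsubC_exp 1?ltnW //.
by rewrite (ltn_eqF im).
Qed.

End Euler.

(** * The sum of the moduli of the coefficients *)

Section PolyNorm.
Variable F : numFieldType.
Implicit Types (p q : {poly F}) (a b : F).

Definition l1norm p : F := \sum_(k < size p) `|p`_k|.

Lemma l1norm_wide p n : (size p <= n)%N -> l1norm p = \sum_(k < n) `|p`_k|.
Proof.
move=> hn; rewrite /l1norm -!(big_mkord predT (fun k => `|p`_k|)).
rewrite [RHS](big_cat_nat (leq0n _) hn) /=.
rewrite [X in _ = _ + X](_ : _ = 0) ?addr0 // big_nat_cond.
by apply: big1 => k /andP[/andP[hk _] _]; rewrite nth_default ?normr0.
Qed.

Lemma l1norm_ge0 p : 0 <= l1norm p.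
Proof. exact: sumr_ge0. Qed.

Lemma l1normD p q : l1norm (p + q) <= l1norm p + l1norm q.
Proof.
have [hp hq] := (leq_maxl (size p) (size q), leq_maxr (size p) (size q)).
rewrite (l1norm_wide (size_polyD p q)) (l1norm_wide hp) (l1norm_wide hq).
by rewrite -big_split ler_sum // => k _; rewrite coefD ler_normD.
Qed.

Lemma l1normZ c p : l1norm (c *: p) = `|c| * l1norm p.
Proof.
rewrite (l1norm_wide (size_scale_leq c p)) mulr_sumr.
by apply: eq_bigr => k _; rewrite coefZ normrM.
Qed.

Lemma l1norm_sum (I : Type) (r : seq I) (P : pred I) (f : I -> {poly F}) :
  l1norm (\sum_(i <- r | P i) f i) <= \sum_(i <- r | P i) l1norm (f i).
Proof.
elim/big_rec2: _ => [|i c p _ h]; first by rewrite /l1norm size_poly0 big_ord0.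
by apply: le_trans (l1normD _ _) _; rewrite lerD2l.
Qed.

Lemma l1norm_XsubC a p : l1norm (('X - a%:P) * p) <= (1 + `|a|) * l1norm p.
Proof.
rewrite mulrBl mul_polyC mulrDl mul1r -scaleNr.
apply: le_trans (l1normD _ _) _; rewrite l1normZ normrN lerD2r.
have [->|p0] := eqVneq p 0; first by rewrite mulr0.
rewrite /l1norm mulrC size_mulX // big_ord_recl coefMX normr0 add0r.
by apply: ler_sum => k _; rewrite coefMX.
Qed.

End PolyNorm.

(** * Hermite interpolation with the Euler derivation *)

Lemma geometric_sum (F : comPzRingType) (B : F) m n : (m <= n)%N ->
  1 + B * (\sum_(m.+1 <= i < n.+1) (1 + B) ^+ (n - i)) = (1 + B) ^+ (n - m).
Proof.
move=> mn; rewrite big_add1 /= mulr_sumr.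
rewrite (eq_big_nat _ _ (F2 := fun i =>
  (- (1 + B) ^+ (n - i.+1)) - (- (1 + B) ^+ (n - i)))).
  by rewrite telescope_sumr // subnn expr0 opprK; ring.
by move=> i /andP[_ i_n]; rewrite -(subnSK i_n) exprS; ring.
Qed.

Section Dual.
Variable F : numFieldType.
Variables (b delta : F) (s : seq F).
Hypotheses (b1 : `|b| = 1) (d0 : 0 < delta) (d1 : delta <= 1).
Hypotheses (s1 : forall a, a \in s -> `|a| = 1).
Hypotheses (sd : forall a, a \in s -> delta <= `|b - a|).

(** The points of s are counted with multiplicity, so this vanishes at each of them
    to the order of its multiplicity; the value at b is normalised to 1. *)
Definition vanishing : {poly F} := \prod_(a <- s) ((b - a)^-1 *: ('X - a%:P)).
Definition hermite (m : nat) : {poly F} := ('X - b%:P) ^+ m * vanishing.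

Lemma euler_XsubC i a : (euler i ('X - a%:P)).[b] = b - a *+ (i == 0%N).
Proof.
case: i => [|i]; first by rewrite euler0 hornerXsubC.
rewrite eulerS derivXsubC mulr1 subr0 (@horner_euler _ _ _ _ 2) ?size_polyX //.
by rewrite !big_ord_recl big_ord0 !coefX /= expr1n !mul1r expr1 mul0r add0r addr0.
Qed.

Lemma deltaV : 1 <= delta^-1.
Proof. by rewrite invf_ge1. Qed.

Lemma euler_exp_le m i :
  `|(euler i (('X - b%:P) ^+ m)).[b]| <= delta ^+ m * (m%:R * delta^-1) ^+ i.
Proof.
elim: m i => [|m IH] i.
  by rewrite !expr0 mul1r mul0r horner_euler1 normrX normr0.
rewrite exprS [delta ^+ _]exprS.
rewrite (_ : m.+1%:R / delta = delta^-1 + m%:R / delta); last first.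
  by rewrite -natr1 mulrDl mul1r addrC.
apply: eulerM_le => // {IH}i; rewrite euler_XsubC; case: i => [|i].
  by rewrite subrr normr0 mulr1 ltW.
by rewrite subr0 b1 exprS mulrA divff ?gt_eqF // mul1r exprn_ege1 // deltaV.
Qed.

Lemma euler_vanishing_le i :
  `|(euler i vanishing).[b]| <= 1 * ((size s)%:R * delta^-1) ^+ i.
Proof.
rewrite /vanishing; elim: s s1 sd i => [|a t IH] h1 hd i.
  by rewrite big_nil mul1r mul0r horner_euler1 normrX normr0.
have /hd ba : a \in a :: t by rewrite inE eqxx.
have ba0 : 0 < `|b - a| := lt_le_trans d0 ba.
rewrite big_cons /= -[X in _ <= X * _]mulr1.
rewrite (_ : (size t).+1%:R / delta = delta^-1 + (size t)%:R / delta); last first.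
  by rewrite -natr1 mulrDl mul1r addrC.
apply: eulerM_le => [{}i|{}i]; last first.
  by apply: IH => c ct; [apply: h1 | apply: hd]; rewrite inE ct orbT.
rewrite mul1r linearZ hornerZ euler_XsubC normrM normfV; case: i => [|i].
  by rewrite /= expr0 mulVf // lt0r_neq0.
rewrite subr0 b1 exprS; apply: ler_pM;
  by rewrite ?invr_ge0 ?lef_pV2 ?posrE ?exprn_ege1 ?deltaV.
Qed.

(** Differentiation at b costs one factor 1 / delta, and the zero of order m at b
    gains delta^m. *)
Lemma euler_hermite_le m i :
  `|(euler i (hermite m)).[b]| <= delta ^+ m * ((m + size s)%:R / delta) ^+ i.
Proof.
rewrite -[_ ^+ m]mulr1 natrD mulrDl.
apply: eulerM_le; [exact: euler_exp_le | exact: euler_vanishing_le].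
Qed.

Lemma horner_vanishing : vanishing.[b] = 1.
Proof.
rewrite /vanishing horner_prod big_seq big1 // => a /sd ba.
have : b - a != 0 by rewrite -normr_gt0 (lt_le_trans d0).
by rewrite hornerZ hornerXsubC => /mulVf.
Qed.

Lemma size_hermite m : (size (hermite m) <= (m + size s).+1)%N.
Proof.
apply: leq_trans (size_polyMleq _ _) _; rewrite size_exp_XsubC addSn /= -addnS leq_add2l.
rewrite /vanishing; elim: s => [|a t IH]; first by rewrite big_nil size_poly1.
rewrite big_cons; apply: leq_trans (size_polyMleq _ _) _.
have := size_scale_leq (b - a)^-1 ('X - a%:P); rewrite size_XsubC => h.
by rewrite -subn1 leq_subLR; exact: leq_add h IH.
Qed.

Lemma l1norm_hermite m :
  l1norm (hermite m) <= 2 ^+ (m + size s) / delta ^+ size s.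
Proof.
rewrite /hermite; elim: m => [|m IH].
  rewrite expr0 mul1r /vanishing; elim: s s1 sd => [|a t IH] h1 hd.
    by rewrite big_nil /l1norm size_poly1 big_ord1 coefC /= normr1 divr1.
  have /hd ba : a \in a :: t by rewrite inE eqxx.
  have ba0 : 0 < `|b - a| := lt_le_trans d0 ba.
  rewrite big_cons -scalerAl l1normZ /= addnS 2!exprS invfM mulrACA.
  have h : l1norm (\prod_(c <- t) ((b - c)^-1 *: ('X - c%:P))) <=
           2 ^+ (0 + size t) / delta ^+ size t.
    by apply: IH => c ct; [apply: h1 | apply: hd]; rewrite inE ct orbT.
  rewrite [2 * _]mulrC -mulrA normfV ler_pM ?invr_ge0 ?l1norm_ge0 //.
    by rewrite lef_pV2.
  apply: le_trans (l1norm_XsubC _ _) _.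
  by rewrite h1 ?inE ?eqxx // ler_wpM2l // addr_ge0.
rewrite exprS -mulrA addSn exprS; apply: le_trans (l1norm_XsubC _ _) _.
by rewrite b1 -[1 + 1]/2 -mulrA ler_wpM2l.
Qed.

(** Downward induction on m: the Euler derivatives of F_m = [hermite m] at b vanish
    below order m, and those of order i > m, of size O(delta^(m-i)), are removed by
    subtracting multiples of the solutions w_i. As w_i has size O(delta^(i-n-d)),
    where d = size s, every correction has the size O(delta^(m-n-d)) that is claimed
    for w_m. The factor (1 + B)^(n-m) solves the recursion
    E_m = E (1 + B sum_(i > m) (1 + B)^(n-i)) between the constants. *)
Lemma hermite_dual n m : (m <= n)%N -> exists w : {poly F},
  [/\ (size w <= (n + size s).+1)%N,
      \prod_(a <- s) ('X - a%:P) %| w,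
      forall i, (i <= n)%N -> (euler i w).[b] = (i == m)%:R &
      l1norm w <= 2 ^+ (n + size s) * (1 + (n + size s).+1%:R ^+ n) ^+ (n - m)
                    * (delta ^+ m / delta ^+ (n + size s))].
Proof.
set B := _.+1%:R ^+ n; set E := 2 ^+ _.
have [t] := ubnP (n - m); elim: t m => // t IH m; rewrite ltnS => mt mn.
have /choice[v vP] : forall k, exists v : {poly F}, (m < k <= n)%N ->
    [/\ (size v <= (n + size s).+1)%N,
      \prod_(a <- s) ('X - a%:P) %| v,
      forall i, (i <= n)%N -> (euler i v).[b] = (i == k)%:R &
      l1norm v <= E * (1 + B) ^+ (n - k)
                    * (delta ^+ k / delta ^+ (n + size s))].
  move=> k.
  have [/andP[mk kn]|kn] := boolP (m < k <= n)%N; last by exists 0.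
  have [|w wP] := IH k _ kn; last by exists w.
  by apply: leq_trans mt; rewrite ltn_sub2l // (leq_trans mk).
pose mu i : F := (euler i (hermite m)).[b].
pose c := (m`!%:R * b ^+ m)^-1.
have c_neq0 : m`!%:R * b ^+ m != 0.
  rewrite -normr_gt0 normrM normrX b1 expr1n mulr1 normr_gt0.
  by rewrite pnatr_eq0 -lt0n fact_gt0.
have dn0 k : 0 < delta ^+ k by rewrite exprn_gt0.
have mu_lt i : (i <= m)%N -> mu i = (m`!%:R * b ^+ m) *+ (i == m).
  by move=> im; rewrite /mu /hermite euler_XsubC_exp // horner_vanishing mulr1.
have mu_le i : (i <= n)%N -> `|mu i| <= B * (delta ^+ m / delta ^+ i).
  move=> i_n; apply: le_trans (euler_hermite_le m i) _.
  rewrite expr_div_n mulrCA ler_pM2r ?divr_gt0 //.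
  apply: (@le_trans _ _ ((n + size s).+1%:R ^+ i)).
    by rewrite lerXn2r ?nnegrE ?ler0n // ler_nat leqW // leq_add2r.
  by rewrite ler_weXn2l // ler1n.
exists (c *: (hermite m - \sum_(m.+1 <= i < n.+1) mu i *: v i)); split.
- apply: leq_trans (size_scale_leq _ _) _.
  apply: leq_trans (size_polyD _ _) _; rewrite size_polyN geq_max.
  rewrite (leq_trans (size_hermite m)) ?ltnS ?leq_add2r //=.
  rewrite big_nat_cond; elim/big_ind: _ => [|p q hp hq|i /andP[hi _]].
  + by rewrite size_poly0.
  + by apply: leq_trans (size_polyD _ _) _; rewrite geq_max hp hq.
  + by apply: leq_trans (size_scale_leq _ _) _; case: (vP i hi).
- rewrite dvdpZr ?invr_eq0 // dvdp_sub //.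
    by apply: dvdp_mull; rewrite /vanishing scaler_prod -mul_polyC dvdp_mull.
  rewrite big_nat_cond; apply: (big_ind (fun p => _ %| p)).
  + by rewrite dvdp0.
  + by move=> p q; apply: dvdp_add.
  + move=> i /andP[hi _].
    by rewrite -mul_polyC dvdp_mull //; case: (vP i hi).
- move=> r rn; rewrite linearZ linearB linear_sum hornerZ hornerD hornerN.
  rewrite horner_sum big_nat_cond.
  under eq_bigr => i /andP[hi _].
    rewrite linearZ hornerZ; have [_ _ -> // _] := vP i hi; over.
  rewrite -big_nat_cond -/(mu r); have [rm|mr] := leqP r m.
    rewrite big_nat big1 => [|i /andP[mi _]].
      by rewrite subr0 mu_lt // mulrnAr mulVf.
    by rewrite ltn_eqF ?mulr0 // (leq_ltn_trans rm).
  rewrite gtn_eqF // (bigD1_seq r) ?mem_index_iota ?mr ?iota_uniq //=.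
  rewrite eqxx mulr1 big1 ?addr0 ?subrr ?mulr0 // => i ir.
  by rewrite eq_sym (negPf ir) mulr0.
- rewrite l1normZ -(geometric_sum _ mn) -/B.
  (* |c| = 1 / m! because |b| = 1. *)
  have c1 : `|c| <= 1.
    rewrite normfV normrM normrX b1 expr1n mulr1 invf_le1 ?normr_nat.
      by rewrite ler1n fact_gt0.
    by rewrite ltr0n fact_gt0.
  apply: le_trans (ler_piMl (l1norm_ge0 _) c1) _.
  apply: le_trans (l1normD _ _) _.
  rewrite -scaleN1r l1normZ normrN1 mul1r mulrDr mulr1 mulrDl lerD //.
    apply: le_trans (l1norm_hermite m) _; apply: ler_pM.
    + by rewrite exprn_ge0.
    + by rewrite invr_ge0 ltW.
    + by rewrite ler_weXn2l ?ler1n // leq_add2r.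
    + rewrite ler_pdivlMr // mulrC exprD mulfK ?gt_eqF //.
      by rewrite ler_wiXn2l // ltW.
  apply: le_trans (l1norm_sum _ _ _) _; rewrite !mulr_sumr mulr_suml.
  apply: ler_sum_nat => i /andP[mi i_n].
  have [_ _ _ hv] := vP i (introT andP (conj mi i_n)).
  rewrite l1normZ; apply: le_trans (ler_pM _ (l1norm_ge0 _) (mu_le i i_n) hv) _ => //.
  rewrite le_eqVlt; apply/orP; left; apply/eqP; field.
  by rewrite !gt_eqF.
Qed.
End Dual.

(** * Chords and arcs of the unit circle *)

Section Chord.
Variable R : realType.

(** With u = s / 2 <= pi / 4, one has sin s = 2 sin u cos u, where cos u is at least
    cos (pi / 4) and sin u >= u cos (pi / 4) by the mean value theorem; and
    cos (pi / 4) ^ 2 = 1 / 2. *)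
Lemma sin_ge_half (s : R) : 0 <= s <= pi / 2 -> s / 2 <= sin s.
Proof.
case/andP=> s0 sp; pose u := s / 2; have su : s = u *+ 2 by rewrite /u; field.
have p2 := pi_ge2 R.
have u0 : 0 <= u by rewrite /u; lra.
have up : u <= pi / 4 by rewrite /u; lra.
have cpi4 : cos (pi / 4) ^+ 2 = 1 / 2 :> R.
  have := cos_mulr2n (pi / 4 : R); rewrite (_ : (pi / 4) *+ 2 = pi / 2); last by field.
  by rewrite cos_pihalf => h; lra.
have cpi4_ge0 : 0 <= cos (pi / 4) :> R by apply: cos_ge0_pihalf; lra.
have cmono (y : R) : 0 <= y <= pi / 4 -> cos (pi / 4) <= cos y.
  move=> /andP[y0 yp]; rewrite le_eqVlt; have [->|ny] := eqVneq y (pi / 4).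
    by rewrite eqxx.
  by rewrite ltr_cos ?in_itv /= ?lt_neqAle ?ny ?yp ?orbT //; lra.
have sinu : u * cos (pi / 4) <= sin u.
  have [->|un0] := eqVneq u 0; first by rewrite sin0 mul0r.
  have u_gt0 : 0 < u by rewrite lt_def un0.
  have [c hc] := MVT u_gt0 (fun x _ => is_derive_sin x)
    (continuous_subspaceT (@continuous_sin R)).
  rewrite sin0 !subr0 => ->; rewrite mulrC ler_pM2r //.
  by move: hc; rewrite in_itv /= => /andP[c0 cu]; apply: cmono; lra.
have cu : cos (pi / 4) <= cos u by apply: cmono; rewrite u0.
rewrite {2}su sin_mulr2n -/u.
have : u * cos (pi / 4) * cos (pi / 4) <= sin u * cos u.
  by apply: ler_pM => //; rewrite mulr_ge0.
by rewrite -mulrA -expr2 cpi4 /u => h; lra.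
Qed.

Lemma normc_eq1 (u : R[i]) : normc u = 1 ->
  u = ((cos (arg u)) +i* (sin (arg u)))%C.
Proof. by move=> u1; have [_ {1}->] := argP u; rewrite u1 !mul1r. Qed.

Lemma angdist_le_pi (u v : R[i]) : angdist u v <= pi.
Proof. by rewrite /angdist ge_min; lra. Qed.

(** The chord has length 2 sin (t / 2), where t is the arc in [0, pi]. *)
Lemma chord_ge (u v : R[i]) : normc u = 1 -> normc v = 1 ->
  angdist u v / 2 <= normc (u - v).
Proof.
move=> u1 v1; set t := angdist u v.
have [[/andP[au1 au2] _] [/andP[av1 av2] _]] := (argP u, argP v).
have t0 : 0 <= t by rewrite /t /angdist le_min normr_ge0 /= subr_ge0 ler_norml; lra.
have tpi : t <= pi := angdist_le_pi u v.
have ct : cos t = cos (arg u - arg v).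
  rewrite /t /angdist minEle; case: ifP => _; first by rewrite cos_norm.
  by rewrite -cosN opprB -cosD2pi -[RHS]cos_norm; congr cos; ring.
have sq : (normc (u - v)) ^+ 2 = (2 * sin (t / 2)) ^+ 2.
  rewrite (normc_eq1 u1) (normc_eq1 v1) /= sqr_sqrtr ?addr_ge0 ?sqr_ge0 //.
  have := cos2Dsin2 (arg u); have := cos2Dsin2 (arg v); have := cos2Dsin2 (t / 2).
  have : cos t = cos (t/2) ^+ 2 *+ 2 - 1 by rewrite -cos_mulr2n; congr cos; field.
  by rewrite ct cosB => *; nra.
have st : t / 2 / 2 <= sin (t / 2) by apply: sin_ge_half; lra.
have n0 : 0 <= normc (u - v) by case: (u - v) => a b; apply: sqrtr_ge0.
by rewrite -(@ler_pXn2r _ 2) ?nnegrE ?divr_ge0 // sq ler_pXn2r ?nnegrE //; lra.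
Qed.

End Chord.

(** * Numbering of the parameters *)

Section Index.
Variables (K : nat) (l : 'I_K -> nat).

Lemma dimRE : dimR l = (\sum_(j < K) (l j).+1)%N.
Proof.
rewrite /dimR; under [RHS]eq_bigr do rewrite -addn1.
by rewrite big_split /= sum1_card card_ord.
Qed.

Lemma offset_ltW (j j' : 'I_K) :
  (j < j')%N -> (offset l j + (l j).+1 <= offset l j')%N.
Proof.
move=> jj; rewrite /offset [leqRHS](bigID (fun m : 'I_K => m < j)%N) /=.
rewrite leq_add //.
  rewrite [leqRHS](eq_bigl (fun m : 'I_K => m < j)%N) // => m.
  by case: (ltnP m j) => mj; rewrite ?andbF // (ltn_trans mj jj).
by rewrite (bigD1 j) /= ?jj ?ltnn // leq_addr.
Qed.

Lemma idx_inj (j j' : 'I_K) (k : 'I_(l j).+1) (k' : 'I_(l j').+1) :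
  idx k = idx k' -> j = j' /\ k = k' :> nat.
Proof.
move=> /(congr1 val) /= e; have [jj|jj|/val_inj jj] := ltngtP j j'.
- have := offset_ltW jj; rewrite leqNgt => /negP[].
  by rewrite (leq_ltn_trans (leq_addr k' _)) // -e ltn_add2l ltn_ord.
- have := offset_ltW jj; rewrite leqNgt => /negP[].
  by rewrite (leq_ltn_trans (leq_addr k _)) // e ltn_add2l ltn_ord.
- by subst j'; split=> //; apply: (@addnI (offset l j)).
Qed.

(** The intervals of indices of the different j are disjoint, and their lengths
    l_j + 1 add up to the dimension. *)
Lemma idx_surj (al : 'I_(dimR l)) :
  exists (j : 'I_K) (k : 'I_(l j).+1), al = idx k.
Proof.
pose T := {j : 'I_K & 'I_(l j).+1}.
pose f (t : T) := idx (tagged t).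
have f_inj : injective f.
  move=> [j k] [j' k'] /idx_inj /= [jj]; subst j' => kk.
  by congr Tagged; apply: val_inj.
have cardT : #|{: T}| = #|'I_(dimR l)|.
  rewrite card_tagged sumnE big_map big_enum /= card_ord dimRE.
  by under eq_bigr do rewrite card_ord.
have [g _ gK] := inj_card_bij f_inj (eq_leq (esym cardT)).
by exists (tag (g al)), (tagged (g al)); rewrite -[LHS]gK.
Qed.

Lemma idx_cases (P : 'I_(dimR l) -> Prop) :
  (forall j k, (k < l j)%N -> P (idxa l j k)) -> (forall j, P (idxz l j)) ->
  forall al, P al.
Proof.
move=> Pa Pz al; have [j [k ->]] := idx_surj al.
have [kl|lk] := ltnP k (l j).
  have -> : idx k = idxa l j k by congr idx; rewrite inord_val.
  exact: Pa.
have -> // : idx k = idxz l j.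
by congr idx; apply: val_inj; apply/eqP; rewrite eqn_leq -ltnS ltn_ord.
Qed.

Lemma idxa_eqE (j j' : 'I_K) (k k' : nat) : (k <= l j)%N -> (k' <= l j')%N ->
  (idxa l j k == idxa l j' k') = (j == j') && (k == k').
Proof.
move=> kl kl'; apply/eqP/andP => [/idx_inj[jj]|[/eqP<- /eqP<-] //].
by rewrite !inordK // => ->; rewrite jj !eqxx.
Qed.

Lemma idxz_idxa j : idxz l j = idxa l j (l j).
Proof. by congr idx; apply: val_inj; rewrite /= inordK. Qed.

End Index.

(** * The entries of the Jacobian matrix *)

Section Jacobian.

Lemma is_derive_coord (C : numFieldType) n (x v : 'rV[C]_n) (p : 'I_n) :
  is_derive x v (fun X : 'rV[C]_n => X 0 p : C) (v 0 p).
Proof.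
have df := differentiable_coord x 0 p.
apply: DeriveDef; first exact: diff_derivable.
rewrite deriveE //.
have @f : {linear 'rV[C]_n -> C}.
  by exists (fun N : 'rV[C]_n => N 0 p); do 2![eexists]; do ?[constructor];
     rewrite ?mxE// => ? *; rewrite ?mxE//; move=> ?; rewrite !mxE.
by rewrite (_ : (fun _ => _) = f) // diff_lin //; apply: coord_continuous.
Qed.

(** Writing the row-valued map as the sum of its components times the unit vectors
    reduces differentiability and derivatives to those of the components. *)
Lemma jacobian_entry (C : numFieldType) m n (f : 'I_n -> 'rV[C]_m -> C) x :
  (forall i, differentiable (f i) x) -> forall al i,
  jacobian (fun X => \row_k f k X) x al i = 'D_(delta_mx 0 al) (f i) x.
Proof.
move=> df al i; pose g k X : 'rV[C]_n := f k X *: delta_mx 0 k.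
have fE : (fun X => \row_k f k X) = \sum_k g k.
  apply/funext => X; rewrite fct_sumE [LHS]row_sum_delta.
  by apply: eq_bigr => k _; rewrite mxE.
have dg k : differentiable (g k) x by apply: differentiableZl.
have dF : differentiable (fun X => \row_k f k X) x.
  by rewrite fE; apply: differentiable_sum.
have -> : jacobian (fun X => \row_k f k X) x al i =
          ((delta_mx 0 al : 'rV_m) *m jacobian (fun X => \row_k f k X) x) 0 i.
  by rewrite -rowE [RHS]mxE.
rewrite -deriveEjacobian // fE derive_sum; last first.
    by move=> k; apply: diff_derivable.
  rewrite summxE (bigD1 i) //= big1 => [|k ki].
    by rewrite addr0 deriveE // diffZl // -deriveE // !mxE !eqxx mulr1.
  by rewrite deriveE // diffZl // !mxE eqxx eq_sym (negPf ki) mulr0.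
Qed.

(** Over an arbitrary field of numbers C, because the normed structure of the
    matrices, which differentiation refers to, is inferred from C as a
    [numFieldType]. *)
Lemma jacobian_exp_sumE (C : numFieldType) (K : nat) (l : 'I_K -> nat)
    (x : 'rV[C]_(dimR l)) (i al : 'I_(dimR l)) :
  jacobian (fun X => \row_(k < dimR l) \sum_(j < K)
    X 0 (idxz l j) ^+ k * \sum_(q < l j) X 0 (idxa l j q) * k%:R ^+ q) x al i =
  \sum_(j < K)
    (x 0 (idxz l j) ^+ i * (\sum_(q < l j) (al == idxa l j q)%:R * i%:R ^+ q) +
     (\sum_(q < l j) x 0 (idxa l j q) * i%:R ^+ q) *
       (i%:R * x 0 (idxz l j) ^+ i.-1 * (al == idxz l j)%:R)).
Proof.
pose f (k : 'I_(dimR l)) (X : 'rV[C]_(dimR l)) : C :=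
  \sum_(j < K) X 0 (idxz l j) ^+ k * \sum_(q < l j) X 0 (idxa l j q) * k%:R ^+ q.
have fE k : f k = \sum_(j < K)
    ((fun X : 'rV[C]_(dimR l) => X 0 (idxz l j) : C) ^+ k *
     \sum_(q < l j)
       (fun X : 'rV[C]_(dimR l) => X 0 (idxa l j q) : C) * cst (k%:R ^+ q)).
  apply/funext => X; rewrite fct_sumE; apply: eq_bigr => j _.
  by rewrite mulrfctE exprfctE fct_sumE.
have df k : differentiable (f k) x.
  rewrite fE; apply: differentiable_sum => j; apply: differentiableM.
    case: (nat_of_ord k) => [|n].
      by rewrite expr0; apply: (differentiable_cst (1 : C) x).
    by apply: differentiableX; apply: differentiable_coord.
  apply: differentiable_sum => q; apply: differentiableM => //.
  exact: differentiable_coord.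
rewrite (jacobian_entry df) fE.
have nd p := is_derive_coord x (delta_mx 0 al) p.
have dS j q := is_deriveM (nd (idxa l j q))
  (is_derive_cst (i%:R ^+ q : C) x (delta_mx 0 al)).
have dj j := is_deriveM (is_deriveX i (nd (idxz l j)))
  (is_derive_sum (fun q : 'I_(l j) => dS j q)).
have [_ ->] := is_derive_sum dj.
apply: eq_bigr => j _; rewrite exprfctE fct_sumE; congr (_ + _).
  congr (_ * _); apply: eq_bigr => q _.
  by rewrite scaler0 add0r /= mxE eqxx eq_sym [LHS]mulrC.
by rewrite -[_ *: _]/(_ * _) -[X in _ * X]/(_ * _) mxE eqxx eq_sym.
Qed.

Variables (R : realType) (K : nat) (l : 'I_K -> nat).

Lemma jacE (x : 'rV[R[i]]_(dimR l)) (i al : 'I_(dimR l)) :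
  jac x i al = \sum_(j < K)
    (node x j ^+ i * (\sum_(q < l j) (al == idxa l j q)%:R * i%:R ^+ q) +
     (\sum_(q < l j) coefa x j q * i%:R ^+ q) *
       (i%:R * node x j ^+ i.-1 * (al == idxz l j)%:R)).
Proof. by rewrite mxE; apply: jacobian_exp_sumE. Qed.

Lemma jac_coefE (x : 'rV[R[i]]_(dimR l)) (i : 'I_(dimR l)) j k : (k < l j)%N ->
  jac x i (idxa l j k) = node x j ^+ i * i%:R ^+ k.
Proof.
move=> kl; rewrite jacE (bigD1 j) //= [X in _ + X = _]big1 => [|j' j'j].
  rewrite idxz_idxa idxa_eqE ?(ltnW kl) // (ltn_eqF kl) andbF !mulr0 !addr0.
  rewrite (bigD1 (Ordinal kl)) //= eqxx mul1r big1 ?addr0 // => q qk.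
  rewrite idxa_eqE ?(ltnW kl) ?(ltnW (ltn_ord q)) // eqxx /=.
  by rewrite eq_sym [_ == k](negPf qk) mul0r.
rewrite idxz_idxa idxa_eqE ?(ltnW kl) // eq_sym (negPf j'j) !mulr0 addr0.
rewrite big1 ?mulr0 // => q _.
by rewrite idxa_eqE ?(ltnW kl) ?(ltnW (ltn_ord q)) // eq_sym (negPf j'j) mul0r.
Qed.

(** The derivative i z^(i-1) equals z^-1 (i z^i), also for i = 0; this makes the column
    of z_j a combination of columns of the confluent Vandermonde matrix. *)
Lemma jac_nodeE (x : 'rV[R[i]]_(dimR l)) (i : 'I_(dimR l)) j : node x j != 0 ->
  jac x i (idxz l j) =
  (node x j)^-1 * \sum_(q < l j) coefa x j q * (node x j ^+ i * i%:R ^+ q.+1).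
Proof.
move=> z0; rewrite jacE (bigD1 j) //= [X in _ + X = _]big1 => [|j' j'j].
  rewrite eqxx mulr1 big1 => [|q _].
    rewrite mulr0 add0r addr0 mulr_suml mulr_sumr; apply: eq_bigr => q _.
    have -> : i%:R * node x j ^+ i.-1 = (node x j)^-1 * (node x j ^+ i * i%:R).
      case: (nat_of_ord i) => [|n]; first by rewrite !mulr0 mul0r.
      by rewrite /= exprS -mulrA mulKf // mulrC.
    by rewrite exprS; ring.
  rewrite idxz_idxa idxa_eqE ?(ltnW (ltn_ord q)) //.
  by rewrite (gtn_eqF (ltn_ord q)) andbF mul0r.
rewrite !idxz_idxa idxa_eqE // eq_sym (negPf j'j) !mulr0 addr0.
rewrite big1 ?mulr0 // => q _.
by rewrite idxa_eqE ?(ltnW (ltn_ord q)) // eq_sym (negPf j'j) mul0r.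
Qed.

End Jacobian.

(** * The real-valued modulus *)

Section Normc.
Variable R : realType.

Definition toC : {rmorphism R -> R[i]} := real_complex R.

Lemma toC_le (a b : R) : (toC a <= toC b) = (a <= b).
Proof. exact: lecR. Qed.

Lemma toC_lt (a b : R) : (toC a < toC b) = (a < b).
Proof. exact: ltcR. Qed.

Lemma normcE_normr (z : R[i]) : `|z| = toC (normc z).
Proof. by case: z => a b; rewrite normc_def. Qed.

Lemma normc_ge0 (z : R[i]) : 0 <= normc z.
Proof. by case: z => a b; apply: sqrtr_ge0. Qed.

Lemma normc_sum (I : Type) (r : seq I) (P : pred I) (f : I -> R[i]) :
  normc (\sum_(i <- r | P i) f i) <= \sum_(i <- r | P i) normc (f i).
Proof.
elim/big_rec2: _ => [|i c p _ h]; first by rewrite normc0.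
by apply: le_trans (le_normcD _ _) _; rewrite lerD2l.
Qed.

Lemma normcX (z : R[i]) n : normc (z ^+ n) = normc z ^+ n.
Proof. by elim: n => [|n IH]; rewrite ?normc1 // !exprS normcM IH. Qed.

Lemma normc_nat n : normc (n%:R : R[i]) = n%:R.
Proof. by rewrite normcMn normc1. Qed.
End Normc.
Arguments toC {R}.

(** * The rows of the inverse Jacobian matrix *)

Section Inverse.
Variables (R : realType) (K : nat) (l : 'I_K -> nat).
Let N := dimR l.
Variable x : 'rV[R[i]]_(dimR l).
Hypothesis unit_node : forall j, normc (node x j) = 1.
Hypothesis sep_gt0 : 0 < sep x.

Lemma nodesep_gt0 j : 0 < nodesep x j.
Proof. by apply: lt_le_trans sep_gt0 _; apply: bigmin_le_cond. Qed.

Lemma nodesep_le_pi j : nodesep x j <= pi.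
Proof. by rewrite /nodesep; apply: bigmin_le_id. Qed.

Lemma nodesep_le j r : r != j -> nodesep x j <= angdist (node x j) (node x r).
Proof. by move=> rj; apply: bigmin_le_cond. Qed.

Lemma node_neq0 j : node x j != 0.
Proof.
apply/eqP => z; have := unit_node j; rewrite z normc0 => /eqP.
by rewrite eq_sym oner_eq0.
Qed.

(** A lower bound for the distances from z_j to the other nodes that is also at most
    1, so that its negative powers increase with the exponent. *)
Definition gap j : R := nodesep x j / pi.

Lemma gap_gt0 j : 0 < gap j.
Proof. by rewrite divr_gt0 ?nodesep_gt0 ?pi_gt0. Qed.

Lemma gap_le1 j : gap j <= 1.
Proof. by rewrite ler_pdivrMr ?pi_gt0 // mul1r nodesep_le_pi. Qed.

Lemma gap_le j r : r != j -> gap j <= normc (node x j - node x r).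
Proof.
move=> rj; apply: le_trans (chord_ge (unit_node j) (unit_node r)).
apply: ler_pM; rewrite ?invr_ge0 ?pi_ge0 ?nodesep_le //; first exact/ltW/nodesep_gt0.
by rewrite lef_pV2 ?posrE ?pi_gt0 // pi_ge2.
Qed.

Definition others (j : 'I_K) : seq R[i] :=
  flatten [seq nseq (l r).+1 (node x r) | r <- index_enum 'I_K & r != j].

Lemma mem_others j a : a \in others j -> exists2 r, r != j & a = node x r.
Proof.
move=> /flatten_mapP[r]; rewrite mem_filter => /andP[rj _] /nseqP[-> _].
by exists r.
Qed.

Lemma size_others j : (l j + size (others j)).+1 = dimR l.
Proof.
rewrite size_flatten sumnE /shape -map_comp big_map big_filter.
under eq_bigr do rewrite /= size_nseq.
by rewrite dimRE [RHS](bigD1 j) //= addSn.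
Qed.

Lemma dvdp_others j r : r != j ->
  ('X - (node x r)%:P) ^+ (l r).+1 %| \prod_(a <- others j) ('X - a%:P).
Proof.
move=> rj; rewrite big_flatten big_map big_filter (bigD1 r) //.
by rewrite big_nseq iter_mulr_1 dvdp_mulr.
Qed.

(** The entries of u V, where V is the confluent Vandermonde matrix. *)
Definition moment (u : 'rV[R[i]]_(dimR l)) j k : R[i] :=
  \sum_(i < dimR l) u 0 i * (i%:R ^+ k * node x j ^+ i).

Definition dual_const : R := 2 ^+ N * (1 + N%:R ^+ N) ^+ N.

Lemma dual_const_ge0 : 0 <= dual_const.
Proof. by rewrite mulr_ge0 ?exprn_ge0 ?addr_ge0 ?exprn_ge0. Qed.

(** The rows of the inverse of the confluent Vandermonde matrix, as coefficient
    vectors of Hermite interpolants at z_j. *)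
Lemma moment_dual j m : (m <= l j)%N -> exists w : 'rV[R[i]]_(dimR l),
  (forall j' k, (k <= l j')%N -> moment w j' k = ((j' == j) && (k == m))%:R) /\
  \sum_(i < dimR l) normc (w 0 i) <= dual_const * (gap j)^-1 ^+ (dimR l - m).
Proof.
move=> mj.
have u1 : `|node x j| = 1 by rewrite normcE_normr unit_node.
have d0 : 0 < toC (gap j) by rewrite -(rmorph0 (@toC R)) toC_lt gap_gt0.
have d1 : toC (gap j) <= 1 by rewrite -(rmorph1 (@toC R)) toC_le gap_le1.
have s1 a : a \in others j -> `|a| = 1.
  by move=> /mem_others[r _ ->]; rewrite normcE_normr unit_node.
have sd a : a \in others j -> toC (gap j) <= `|node x j - a|.
  by move=> /mem_others[r rj ->]; rewrite normcE_normr toC_le gap_le.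
have [w [sw dw ew nw]] := hermite_dual u1 d0 d1 s1 sd mj.
rewrite size_others in sw nw.
exists (\row_(i < dimR l) w`_i); split=> [j' k kj'|].
  rewrite /moment (_ : \sum_i _ = (euler k w).[node x j']); last first.
    by rewrite (horner_euler _ _ sw); apply: eq_bigr => i _; rewrite mxE.
  case: (eqVneq j' j) kj' => [->|jj] kj'; first exact: ew.
  apply: (euler_dvd (m := (l j').+1)) => //.
  exact: dvdp_trans (dvdp_others jj) dw.
have -> : \sum_(i < dimR l) normc ((\row_(i < dimR l) w`_i) 0 i)
         = \sum_(i < dimR l) normc w`_i.
  by apply: eq_bigr => i _; rewrite mxE.
have sumC : l1norm w = toC (\sum_(i < dimR l) normc w`_i).
  rewrite (l1norm_wide sw) rmorph_sum; apply: eq_bigr => i _.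
  exact: normcE_normr.
rewrite -toC_le -sumC; apply: le_trans nw _.
rewrite /dual_const -/N.
have -> : (1 + N%:R ^+ l j) ^+ (l j - m) =
          @toC R ((1 + N%:R ^+ l j) ^+ (l j - m)).
  rewrite (rmorphXn (@toC R)) (rmorphD (@toC R)) (rmorphXn (@toC R)).
  by rewrite (rmorph1 (@toC R)) rmorph_nat.
have -> : 2 ^+ (l j + size (others j)) = @toC R (2 ^+ (l j + size (others j))).
  by rewrite rmorphXn rmorph_nat.
rewrite -!(rmorphXn (@toC R)) -(fmorphV (@toC R)) -!(rmorphM (@toC R)) toC_le.
have sN : (l j + size (others j) < N)%N by rewrite size_others.
have lN : (l j <= N)%N by apply: leq_trans (leq_addr _ _) (ltnW sN).
have N1 : 1 <= N%:R :> R by rewrite ler1n; apply: leq_ltn_trans sN.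
have N0 : 0 <= N%:R :> R := ler0n _ _.
apply: ler_pM.
- by rewrite mulr_ge0 ?exprn_ge0 ?addr_ge0 ?exprn_ge0.
- by rewrite divr_ge0 ?exprn_ge0 ?ltW ?gap_gt0.
- apply: ler_pM.
  + by rewrite exprn_ge0.
  + by rewrite exprn_ge0 ?addr_ge0 ?exprn_ge0.
  + by rewrite ler_weXn2l ?ler1n // ltnW.
  + apply: (@le_trans _ _ ((1 + N%:R ^+ N) ^+ (l j - m))).
      rewrite lerXn2r ?nnegrE ?addr_ge0 ?exprn_ge0 // lerD2l.
      by rewrite ler_weXn2l.
    rewrite ler_weXn2l ?lerDl ?exprn_ge0 //.
    exact: leq_trans (leq_subr _ _) lN.
- have mN : (m <= l j + size (others j))%N by apply: leq_trans mj (leq_addr _ _).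
  rewrite -(subnK mN) exprD invfM mulrCA mulfV ?expf_neq0 ?gt_eqF ?gap_gt0 // mulr1.
  rewrite -exprVn ler_weXn2l ?invf_ge1 ?gap_gt0 ?gap_le1 //.
  by rewrite leq_sub2r // ltnW.
Qed.

Hypothesis lead_neq0 : forall j, coefa x j (l j).-1 != 0.
Hypothesis l_gt0 : forall j, (1 <= l j)%N.

Lemma mulmx_jac_coef (u : 'rV[R[i]]_(dimR l)) j k : (k < l j)%N ->
  (u *m jac x) 0 (idxa l j k) = moment u j k.
Proof.
move=> kl; rewrite mxE; apply: eq_bigr => i _.
by rewrite jac_coefE // [_ ^+ i * _]mulrC.
Qed.

Lemma mulmx_jac_node (u : 'rV[R[i]]_(dimR l)) j :
  (u *m jac x) 0 (idxz l j) =
  (node x j)^-1 * \sum_(q < l j) coefa x j q * moment u j q.+1.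
Proof.
rewrite mxE.
under eq_bigr => i _ do rewrite (jac_nodeE _ (node_neq0 j)) mulrCA mulr_sumr.
rewrite -mulr_sumr exchange_big /=; congr (_ * _); apply: eq_bigr => q _.
rewrite mulr_sumr; apply: eq_bigr => i _.
by rewrite mulrCA [_ ^+ i * _]mulrC.
Qed.

Lemma mulmx_jac_eq_delta (u : 'rV[R[i]]_(dimR l)) al :
  (forall j k, (k < l j)%N -> moment u j k = (al == idxa l j k)%:R) ->
  (forall j, (node x j)^-1 * (\sum_(q < l j) coefa x j q * moment u j q.+1) =
             (al == idxz l j)%:R) ->
  u *m jac x = delta_mx 0 al.
Proof.
move=> hc hz; apply/rowP => be; rewrite [RHS]mxE eqxx /= [be == _]eq_sym.
move: be; apply: idx_cases => [j k kl|j].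
  by rewrite mulmx_jac_coef // hc.
by rewrite mulmx_jac_node hz.
Qed.

Lemma moment_lin (c d : R[i]) (u v : 'rV[R[i]]_(dimR l)) j k :
  moment (c *: u + d *: v) j k = c * moment u j k + d * moment v j k.
Proof.
rewrite /moment !mulr_sumr -big_split; apply: eq_bigr => i _.
by rewrite !mxE /= mulrDl !mulrA.
Qed.

Lemma sum_coefa_delta j k : (k <= l j)%N ->
  \sum_(q < l j) coefa x j q * (q.+1 == k)%:R = coefa_prev x j k.
Proof.
case: k => [|k] kl /=; first by rewrite big1 // => q _; rewrite mulr0.
rewrite (bigD1 (Ordinal kl)) //= eqxx mulr1 big1 ?addr0 // => q qk.
case: eqVneq => [e|_]; last by rewrite !mulr0.
by case/eqP: qk; apply: val_inj; case: e.
Qed.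

Lemma coefa_prev_last j : coefa_prev x j (l j) = coefa x j (l j).-1.
Proof. by have := l_gt0 j; case: (l j). Qed.

(** The column of z_j pairs with w_(j,k) to a_(k-1,j) / z_j and with w_(j,l_j) to
    a_(l_j-1,j) / z_j; the multiple of w_(j,l_j) is chosen to make the row orthogonal
    to that column. *)
Lemma coef_row j k : (k < l j)%N -> exists u : 'rV[R[i]]_(dimR l),
  u *m jac x = delta_mx 0 (idxa l j k) /\
  \sum_(i < dimR l) normc (u 0 i) <= dual_const * (gap j)^-1 ^+ (dimR l - k) *
    (1 + normc (coefa_prev x j k) / normc (coefa x j (l j).-1)).
Proof.
move=> kl; have [w [wm wn]] := moment_dual (ltnW kl).
have [w' [wm' wn']] := moment_dual (leqnn (l j)).
set c := coefa_prev x j k / coefa x j (l j).-1.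
exists (1 *: w + (- c) *: w'); split.
  apply: mulmx_jac_eq_delta => [j' q ql|j'].
    rewrite moment_lin mul1r wm ?wm' ?(ltnW ql) // idxa_eqE ?(ltnW ql) ?(ltnW kl) //.
    rewrite eq_sym [q == k]eq_sym.
    have [jj|_] := eqVneq j j'; last by rewrite mulr0 addr0.
    by move: ql; rewrite -jj => ql; rewrite (ltn_eqF ql) mulr0 addr0.
  rewrite idxz_idxa idxa_eqE ?(ltnW kl) //.
  under eq_bigr => q _ do rewrite moment_lin mul1r wm ?wm' ?ltn_ord //.
  have [<-|jj] := eqVneq j j'; last first.
    by rewrite big1 ?mulr0 // => q _; rewrite mulr0 addr0 mulr0.
  rewrite (ltn_eqF kl) /=; under eq_bigr => q _ do rewrite mulrDr mulrCA.
  rewrite big_split /= -mulr_sumr !sum_coefa_delta ?(ltnW kl) //.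
  by rewrite coefa_prev_last /c mulNr divfK // subrr mulr0.
have nc : normc (coefa_prev x j k) / normc (coefa x j (l j).-1) = normc c.
  by rewrite /c normcM normcV.
rewrite nc mulrDr mulr1.
apply: (@le_trans _ _
  (\sum_(i < dimR l) (normc (w 0 i) + normc c * normc (w' 0 i)))).
  apply: ler_sum => i _; rewrite !mxE mul1r.
  by apply: le_trans (le_normcD _ _) _; rewrite mulNr normcN normcM.
rewrite big_split /= -mulr_sumr lerD // mulrC ler_wpM2r ?normc_ge0 //.
apply: le_trans wn' _; rewrite ler_wpM2l ?dual_const_ge0 //.
by rewrite ler_weXn2l ?invf_ge1 ?gap_gt0 ?gap_le1 // leq_sub2l // ltnW.
Qed.

Lemma node_row j : exists u : 'rV[R[i]]_(dimR l),
  u *m jac x = delta_mx 0 (idxz l j) /\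
  \sum_(i < dimR l) normc (u 0 i) <= dual_const * (gap j)^-1 ^+ (dimR l - l j) *
    (1 / normc (coefa x j (l j).-1)).
Proof.
have [w [wm wn]] := moment_dual (leqnn (l j)).
set c := node x j / coefa x j (l j).-1.
exists (c *: w + 0 *: w); split.
  apply: mulmx_jac_eq_delta => [j' q ql|j'].
    rewrite moment_lin mul0r addr0 wm ?(ltnW ql) //.
    rewrite idxz_idxa idxa_eqE ?(ltnW ql) //.
    rewrite eq_sym [_ == q]eq_sym.
    have [jj|_] := eqVneq j j'; last by rewrite mulr0.
    by move: ql; rewrite -jj => ql; rewrite (ltn_eqF ql) mulr0.
  under eq_bigr => q _ do rewrite moment_lin mul0r addr0 wm ?ltn_ord //.
  rewrite !idxz_idxa idxa_eqE //.
  have [<-|jj] := eqVneq j j'; last first.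
    by rewrite big1 ?mulr0 // => q _; rewrite !mulr0.
  rewrite eqxx; under eq_bigr => q _ do rewrite mulrCA.
  rewrite -mulr_sumr sum_coefa_delta // coefa_prev_last /c divfK //.
  by rewrite mulVf // node_neq0.
under eq_bigr => i _ do rewrite !mxE mul0r addr0 normcM.
rewrite -mulr_sumr [leRHS]mulrC /c normcM unit_node mul1r normcV.
by rewrite mul1r ler_wpM2l // invr_ge0 normc_ge0.
Qed.

Lemma jac_unitmx : jac x \in unitmx.
Proof.
have /choice[u hu] : forall al, exists u : 'rV[R[i]]_(dimR l),
    u *m jac x = delta_mx 0 al.
  apply: idx_cases => [j k kl|j].
    by have [u [hu _]] := coef_row kl; exists u.
  by have [u [hu _]] := node_row j; exists u.
have : (\matrix_al u al) *m jac x = 1%:M.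
  by apply/row_matrixP => al; rewrite row_mul rowK hu rowE mulmx1.
by case/mulmx1_unit.
Qed.

(** As u is the row of the inverse with index al, its norm only has to be multiplied
    by a bound for the |m_i|, in which the powers of the nodes have modulus 1. *)
Lemma kappa_le (A B : R) al (u : 'rV[R[i]]_(dimR l)) :
  (forall j k, (k < l j)%N -> normc (coefa x j k) <= A) ->
  u *m jac x = delta_mx 0 al ->
  \sum_(i < dimR l) normc (u 0 i) <= B ->
  kappa al x <= B * (A * \sum_(j < K) \sum_(q < l j) N%:R ^+ q).
Proof.
move=> hA hu hB.
have uE i : invmx (jac x) al i = u 0 i.
  have : delta_mx 0 al *m invmx (jac x) = u by rewrite -hu mulmxK // jac_unitmx.
  by rewrite -rowE => <-; rewrite mxE.
set M := A * _.
have fM i : normc (forward x 0 i) <= M.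
  rewrite mxE /M mulr_sumr; apply: le_trans (normc_sum _ _ _) _; apply: ler_sum => j _.
  rewrite normcM normcX unit_node expr1n mul1r mulr_sumr.
  apply: le_trans (normc_sum _ _ _) _; apply: ler_sum => q _.
  rewrite normcM normcX normc_nat ler_pM ?normc_ge0 ?exprn_ge0 ?hA //.
  by rewrite lerXn2r ?nnegrE ?ler0n // ler_nat ltnW.
rewrite /kappa; apply: (@le_trans _ _ (\sum_(i < dimR l) normc (u 0 i) * M)).
  by apply: ler_sum => i _; rewrite uE ler_wpM2l ?normc_ge0.
rewrite -mulr_suml ler_wpM2r //.
exact: le_trans (normc_ge0 _) (fM al).
Qed.
End Inverse.

(** * The condition numbers *)

Theorem theorem2p2 (R : realType) (K : nat) (l : 'I_K -> nat)
    (hK : (1 <= K)%N) (hl : forall j, (1 <= l j)%N) :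
  exists C3 C4 : R, forall (A : R) (x : 'rV[R[i]]_(dimR l)),
    (forall j, normc (node x j) = 1) ->
    0 < sep x ->
    (forall j, coefa x j (l j).-1 != 0) ->
    (forall j k, (k < l j)%N -> normc (coefa x j k) <= A) ->
    jac x \in unitmx /\
    forall j : 'I_K,
      (forall k : nat, (k < l j)%N ->
        kappa (idxa l j k) x <=
          C3 * A * (1 / nodesep x j) ^+ (dimR l - k) *
          (1 + normc (coefa_prev x j k) / normc (coefa x j (l j).-1))) /\
      kappa (idxz l j) x <=
        C4 * A * (1 / nodesep x j) ^+ (dimR l - l j) *
        (1 / normc (coefa x j (l j).-1)).
Proof.
pose S : R := \sum_(j < K) \sum_(q < l j) (dimR l)%:R ^+ q.
pose C : R := dual_const R l * pi ^+ dimR l * S.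
have S0 : 0 <= S.
  by apply: sumr_ge0 => j _; apply: sumr_ge0 => q _; rewrite exprn_ge0.
exists C, C => A x x1 sx xl hA; split; first exact: jac_unitmx.
move=> j.
have A0 : 0 <= A by apply: le_trans (normc_ge0 _) (hA j 0%N (hl j)).
(* Passing from gap = nodesep / pi to nodesep costs at most pi ^+ dimR l. *)
have gap_to_sep n f : (n <= dimR l)%N -> 0 <= f ->
    dual_const R l * (gap x j)^-1 ^+ n * f * (A * S) <=
    C * A * (1 / nodesep x j) ^+ n * f.
  move=> nN f0.
  have -> : (gap x j)^-1 ^+ n = pi ^+ n * (1 / nodesep x j) ^+ n.
    by rewrite -exprMn /gap invf_div div1r.
  pose P := dual_const R l * A * S * (1 / nodesep x j) ^+ n * f.
  rewrite [leLHS](_ : _ = P * pi ^+ n); last by rewrite /P; ring.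
  rewrite [leRHS](_ : _ = P * pi ^+ dimR l); last by rewrite /P /C; ring.
  rewrite ler_wpM2l ?ler_weXn2l //.
    rewrite /P !mulr_ge0 ?dual_const_ge0 ?exprn_ge0 // divr_ge0 // ltW //.
    exact: nodesep_gt0.
  by rewrite (le_trans _ (pi_ge2 R)) // ler1n.
split=> [k kl|].
  have [u [hu nu]] := coef_row x1 sx xl hl kl.
  apply: le_trans (kappa_le x1 sx xl hl hA hu nu) _.
  apply: gap_to_sep; first exact: leq_subr.
  by rewrite addr_ge0 // divr_ge0 ?normc_ge0.
have [u [hu nu]] := node_row x1 sx xl hl j.
apply: le_trans (kappa_le x1 sx xl hl hA hu nu) _.
apply: gap_to_sep; first exact: leq_subr.
by rewrite divr_ge0 ?normc_ge0.
Qed.
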